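(* Let $\mathbb K$ be a field of characteristic $0$ and $R=\mathbb K[x,y,z]$. Let $\mathcal A=\{\ell_1,\ldots,\ell_n\}\subset R$ be an essential line arrangement in $\mathbb P^2$. Let $Sing(\mathcal A)=\{P_1,\ldots,P_s\}$ and $n_j=|\mathcal A_{P_j}|$ for $j=1,\ldots,s$. Then in $R$ we have the primary decomposition $$I_{n-2}(\mathcal A)=I(P_1)^{n_1-2}\cap\cdots\cap I(P_s)^{n_s-2}\cap\langle x,y,z\rangle^{n-2}.$$
   Context: A line arrangement $\mathcal A=\{\ell_1,\ldots,\ell_n\}$ in $\mathbb P^2$ is given by linear forms in $R=\mathbb K[x,y,z]$, no two of which are proportional, each defining the line $V(\ell_i)\subset\mathbb P^2$; it is essential if $\ell_1,\ldots,\ell_n$ span the space of linear forms of $R$ (rank $3$). $Sing(\mathcal A)$ is the set of (distinct) points of $\mathbb P^2$ in which at least two of the lines of $\mathcal A$ intersect. For $P\in Sing(\mathcal A)$, $\mathcal A_P$ is the set of lines of $\mathcal A$ passing through $P$, and $I(P)\subset R$ is the homogeneous (linear prime, height 2) ideal of $P$. By convention $I^0=R$ for any ideal $I$ (such factors are simply omitted from the decomposition). For $1\le a\le n$, $I_a(\mathcal A)$ is the ideal of $R$ generated by all products $\ell_{i_1}\cdots\ell_{i_a}$ with $1\le i_1<\cdots<i_a\le n$. *)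

(* Defs.v *)
From HB Require Import structures.
From mathcomp Require Import all_boot all_order all_algebra.
From mathcomp Require Import mpoly.

Set Implicit Arguments.
Unset Strict Implicit.
Unset Printing Implicit Defensive.

Import GRing.Theory.
Local Open Scope ring_scope.

(* Ideals are Prop-valued predicates, since membership is not assumed to be
   decidable; two ideals are equal when they have the same elements. *)
Section Ideals.
Variable R : comNzRingType.
Implicit Types I J Q : R -> Prop.

Definition is_ideal I :=
  [/\ I 0, forall f g, I f -> I g -> I (f + g) & forall a f, I f -> I (a * f)].

Definition ideal_gen (S : R -> Prop) : R -> Prop := fun f =>
  exists (m : nat) (a g : 'I_m -> R),
    (forall i, S (g i)) /\ f = \sum_(i < m) a i * g i.

(* For k = 0 the only generator is the empty product, so I ^ 0 = R. *)
Definition ideal_exp I (k : nat) : R -> Prop :=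
  ideal_gen (fun f =>
    exists g : 'I_k -> R, (forall i, I (g i)) /\ f = \prod_(i < k) g i).

Definition primary_ideal Q :=
  [/\ is_ideal Q, ~ Q 1
    & forall f g, Q (f * g) -> Q f \/ exists k : nat, Q (g ^+ k)].

End Ideals.

Section Plane.
Variable K : fieldType.

(* The points of P^2 are the lines through the origin of K^3, so that equality
   of points is Leibniz equality. *)
Definition proj_plane := {P : {vspace 'rV[K]_3} | \dim P == 1%N}.

(* Evaluation at a chosen vector of homogeneous coordinates; it is only meant
   for homogeneous f, see [vanishes_atP]. *)
Definition vanishes_at (f : {mpoly K[3]}) (P : proj_plane) : bool :=
  f.@[fun i => vpick (val P) 0 i] == 0.

Lemma meval_dhomogZ (d : nat) (f : {mpoly K[3]}) (c : K) (v : 'rV[K]_3) :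
  f \is d.-homog ->
  f.@[fun i => (c *: v) 0 i] = c ^+ d * f.@[fun i => v 0 i].
Proof.
move=> /dhomogP fd; rewrite !mevalE mulr_sumr; apply: eq_big_seq => m /fd dm.
rewrite mulrCA; congr (_ * _).
rewrite -dm /= mdegE -prodrXr -big_split /=.
by apply: eq_bigr => i _; rewrite mxE exprMn.
Qed.

Lemma vanishes_atP (d : nat) (f : {mpoly K[3]}) (P : proj_plane) :
  f \is d.-homog ->
  reflect (forall v, v \in val P -> v != 0 -> f.@[fun i => v 0 i] = 0)
          (vanishes_at f P).
Proof.
move=> fd; have P0 : vpick (val P) != 0.
  by rewrite vpick0 -dimv_eq0 (eqP (valP P)).
apply: (iffP eqP) => [f0 v vP _|]; last by apply=> //; exact: memv_pick.
have /eqP eP : <[vpick (val P)]>%VS == val P.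
  rewrite -(dimv_leqif_eq (_ : (<[_]> <= val P)%VS)); last first.
    by rewrite -memvE memv_pick.
  by rewrite dim_vline P0 (eqP (valP P)).
move: vP; rewrite -eP => /vlineP[c ->].
by rewrite (meval_dhomogZ _ _ fd) f0 mulr0.
Qed.

Definition point_ideal (P : proj_plane) : {mpoly K[3]} -> Prop :=
  ideal_gen (fun f => (exists d : nat, f \is d.-homog) /\ vanishes_at f P).

Definition irrelevant_ideal : {mpoly K[3]} -> Prop :=
  ideal_gen (fun f => exists i : 'I_3, f = 'X_i).

Variable n : nat.
Implicit Type l : 'I_n -> {mpoly K[3]}.

Definition line_arrangement l :=
  (forall i, l i \is 1.-homog /\ l i != 0) /\
  (forall i j, i != j -> forall c : K, l i <> c *: l j).

Definition essential l :=
  forall f : {mpoly K[3]}, f \is 1.-homog ->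
    exists c : 'I_n -> K, f = \sum_(i < n) c i *: l i.

Definition lines_through l (P : proj_plane) : {set 'I_n} :=
  [set i | vanishes_at (l i) P].

Definition Sing l (P : proj_plane) : bool := (2 <= #|lines_through l P|)%N.

Definition fold_products_ideal l (a : nat) : {mpoly K[3]} -> Prop :=
  ideal_gen (fun f =>
    exists A : {set 'I_n}, #|A| = a /\ f = \prod_(i in A) l i).

End Plane.

(* Main.v *)
Require Import Defs.
From HB Require Import structures.
From mathcomp Require Import all_boot all_order all_algebra.
From mathcomp Require Import mpoly ring.

(** Write [J_k] for the intersection of the powers of the ideals of points and
    of the irrelevant ideal in which every exponent is a number of lines (all of
    them, or those through the point) minus [k], and [I_k] for the ideal
    generated by the products of all the lines but [k]. The inclusion of [I_k]
    in [J_k] is a count ([omit_fat]); the theorem is the converse for [k = 2].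

    It is proved by deleting a line [m] of the arrangement. Restrict an element
    [f] of [J_2] to [m]. The other lines cut [m] in a multiset of points, and
    the restriction of [f] vanishes at each of them to order at least its
    multiplicity minus one, while its order at the origin is at least their
    number minus one. This forces the restriction of [f] to lie in the ideal
    generated by the products of all but one of the restricted lines
    ([omit1_restriction], by induction on the number of these lines: split off
    the restriction of one line, after subtracting a multiple of the product of
    the others if the point that it cuts out is simple). Hence [f = g + h * m],
    where [g] is a combination of products of all but one of the remaining
    lines, that is, of all but two of the lines of the arrangement. The residue
    [h] then satisfies the hypotheses for the arrangement without [m]
    ([fat_residual]), and the induction goes on ([fat2_omit]).

    What is needed of the powers [I ^ k], for [I] the ideal of a point or the
    irrelevant ideal, is that the order of a polynomial along [I] is additive
    under products: a linear form can then be cancelled at the cost of its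
    order, and the powers are primary. To get it, take a vector [v] that spans
    the point ([v = 0] for the irrelevant ideal) and a linear form [l] with
    [l(v) = 1] ([l = 0] if [v = 0]), and substitute [v l + T (x - v l)] for the
    coordinates [x]. This is a ring morphism [t] to the polynomials in [T],
    which maps [I ^ k] to the multiples of [T^k] and is a section of the
    evaluation at [T = 1] with values in the Rees algebra of [I]; so
    [f] lies in [I ^ k] if and only if [T^k] divides [t f] ([ideal_expE]),
    and additivity is that of the order in [T]. *)

Set Implicit Arguments.
Unset Strict Implicit.
Unset Printing Implicit Defensive.

Import GRing.Theory.
Local Open Scope ring_scope.

(** * Ideals and their powers *)

Section IdealTheory.
Variable R : comNzRingType.
Implicit Types (I J : R -> Prop) (f g : R).

Lemma idealN I f : is_ideal I -> I f -> I (- f).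
Proof. by case=> _ _ IM If; rewrite -mulN1r; apply: IM. Qed.

Lemma idealB I f g : is_ideal I -> I f -> I g -> I (f - g).
Proof. by move=> hI If /(idealN hI); case: hI => _ ID _; apply: ID. Qed.

Lemma ideal_sum I (T : Type) (r : seq T) (C : pred T) (F : T -> R) :
  is_ideal I -> (forall x, C x -> I (F x)) -> I (\sum_(x <- r | C x) F x).
Proof. by case=> I0 ID _ IF; elim/big_ind: _. Qed.

Lemma ideal_gen_is_ideal S : is_ideal (@ideal_gen R S).
Proof.
split.
- by exists 0%N, (fun=> 0), (fun=> 0); split; [case|rewrite big_ord0].
- move=> f1 f2 [m1 [a1 [g1 [S1 ->]]]] [m2 [a2 [g2 [S2 ->]]]].
  pose glue (u1 : 'I_m1 -> R) u2 i :=
    match @split m1 m2 i with inl j => u1 j | inr j => u2 j end.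
  exists (m1 + m2)%N, (glue a1 a2), (glue g1 g2); split=> [i|].
    by rewrite /glue; case: split.
  rewrite big_split_ord /=; congr (_ + _); apply: eq_bigr => i _.
    by rewrite /glue (unsplitK (inl i)).
  by rewrite /glue (unsplitK (inr i)).
- move=> c f [m [a [g [Sg ->]]]]; exists m, (fun i => c * a i), g.
  by split=> //; rewrite mulr_sumr; apply: eq_bigr => i _; rewrite mulrA.
Qed.

Lemma ideal_gen_in (S : R -> Prop) f : S f -> ideal_gen S f.
Proof.
by move=> Sf; exists 1%N, (fun=> 1), (fun=> f); rewrite big_ord1 mul1r.
Qed.

Lemma ideal_gen_min (S : R -> Prop) I : is_ideal I -> (forall f, S f -> I f) ->
  forall f, ideal_gen S f -> I f.
Proof.
move=> hI SI f [m [a [g [Sg ->]]]]; apply: ideal_sum => // i _.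
by case: hI => _ _; apply; apply: SI.
Qed.

Lemma ideal_exp_is_ideal I k : is_ideal (ideal_exp I k).
Proof. exact: ideal_gen_is_ideal. Qed.

Lemma ideal_exp0 I f : ideal_exp I 0 f.
Proof.
have [_ _ /(_ f 1) H] := ideal_exp_is_ideal I 0.
rewrite -[f]mulr1; apply/H/ideal_gen_in.
by exists (fun=> 0); split; [case|rewrite big_ord0].
Qed.

Lemma ideal_expS I k f g :
  I f -> ideal_exp I k g -> ideal_exp I k.+1 (f * g).
Proof.
move=> If; apply: (ideal_gen_min (I := fun g => ideal_exp I k.+1 (f * g))).
  have [e0 eD eM] := ideal_exp_is_ideal I k.+1.
  split=> [|g1 g2|a g1]; rewrite ?mulr0 ?mulrDr //; first exact: eD.
  by rewrite mulrCA; apply: eM.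
move=> _ [u [Iu ->]]; apply: ideal_gen_in.
exists (fun i => if unlift ord0 i is Some j then u j else f); split=> [i|].
  by case: unlift.
rewrite big_ord_recl unlift_none; congr (_ * _).
by apply: eq_bigr => i _; rewrite liftK.
Qed.

Lemma ideal_expM I a b f g :
  ideal_exp I a f -> ideal_exp I b g -> ideal_exp I (a + b) (f * g).
Proof.
move=> + Ig; apply: (ideal_gen_min (I := fun f => ideal_exp I (a + b) (f * g))).
  have [e0 eD eM] := ideal_exp_is_ideal I (a + b).
  split=> [|g1 g2|c g1]; rewrite ?mul0r ?mulrDl -?mulrA //; first exact: eD.
  exact: eM.
move=> _ [u [Iu ->]]; elim: a u Iu => [|a IH] u Iu.
  by rewrite big_ord0 mul1r.
by rewrite big_ord_recl -mulrA; apply: ideal_expS => //; apply: IH => i.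
Qed.

Lemma ideal_exp1 I f : I f -> ideal_exp I 1 f.
Proof. by move=> If; rewrite -[f]mulr1; apply/ideal_expS/ideal_exp0. Qed.

Lemma ideal_exp_le I a b f : (b <= a)%N -> ideal_exp I a f -> ideal_exp I b f.
Proof.
move=> /subnK<-; apply: ideal_gen_min => [|_ [u [Iu ->]]].
  exact: ideal_exp_is_ideal.
have [_ _] := ideal_exp_is_ideal I b; rewrite big_split_ord /=; apply.
by apply: ideal_gen_in; exists (fun i => u (rshift _ i)).
Qed.

Lemma ideal_exp_sub I k f : is_ideal I -> (0 < k)%N -> ideal_exp I k f -> I f.
Proof.
move=> hI k0 /(ideal_exp_le k0); apply: ideal_gen_min => // _ [u [Iu ->]].
by rewrite big_ord1.
Qed.

Lemma ideal_exp_morph (phi : {rmorphism R -> R}) I J k f :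
  (forall g, I g -> J (phi g)) -> ideal_exp I k f -> ideal_exp J k (phi f).
Proof.
move=> IJ; apply: (ideal_gen_min (I := fun f => ideal_exp J k (phi f))).
  have [e0 eD eM] := ideal_exp_is_ideal J k.
  by split=> [|g h|a g]; rewrite ?(rmorph0, rmorphD, rmorphM) //;
    [apply: eD|apply: eM].
move=> _ [u [Iu ->]]; rewrite rmorph_prod.
by apply: ideal_gen_in; exists (phi \o u); split=> // i; apply: IJ.
Qed.

Lemma ideal_exp_prod I (T : finType) (F : T -> R) (B C : {set T}) :
  (forall i, i \in C -> I (F i)) ->
  ideal_exp I #|B :&: C| (\prod_(i in B) F i).
Proof.
move=> IF; rewrite (big_setID C) /= mulrC.
have [_ _] := ideal_exp_is_ideal I #|B :&: C|; apply.
move: {B}(B :&: C) (subsetIr B C) => A sAC; move: {2}#|A| (erefl #|A|) => k cA.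
rewrite cA; elim: k A cA sAC => [|k IH] A cA sAC; first exact: ideal_exp0.
have /card_gt0P[i iA] : (0 < #|A|)%N by rewrite cA.
rewrite (big_setD1 i) //=; apply: ideal_expS; first exact/IF/(subsetP sAC).
apply: IH; last exact: subset_trans (subsetDl _ _) sAC.
by move: (cardsD1 i A); rewrite iA cA => -[].
Qed.

End IdealTheory.

(** * Order along an ideal, read on a section of its Rees algebra *)

(** The third condition places the values of [t] in the Rees algebra, the
    direct sum of the [I ^ j T^j]. *)
Definition rees_section (R : comNzRingType) (I : R -> Prop)
    (t : {rmorphism R -> {poly R}}) :=
  [/\ is_ideal I, forall f, (t f).[1] = f,
      forall f j, ideal_exp I j (t f)`_j & forall f, I f -> (t f)`_0 = 0].

Lemma drop1_poly (R : nzRingType) (p : {poly R}) :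
  p`_0 = 0 -> drop_poly 1 p * 'X = p.
Proof.
move=> p0; rewrite -[RHS](poly_take_drop 1) expr1.
suff -> : take_poly 1 p = 0 by rewrite add0r.
by apply/polyP=> -[|j]; rewrite coef_take_poly coef0.
Qed.

Section ReesSection.
Variables (R : idomainType) (I : R -> Prop) (t : {rmorphism R -> {poly R}}).
Hypothesis tI : rees_section I t.
Implicit Types f g : R.

(** One direction is multiplicativity of [t]; the other evaluates at [T = 1],
    since the [j]-th coefficient of [t f] is in [I ^ j]. *)
Lemma ideal_expE k f : ideal_exp I k f <-> exists q, t f = q * 'X^k.
Proof.
have [hI t1 tE t0] := tI; split.
  apply: (ideal_gen_min (I := fun f => exists q, t f = q * 'X^k)).
    split=> [|g h [q eg] [r eh]|a g [q eg]].
    - by exists 0; rewrite rmorph0 mul0r.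
    - by exists (q + r); rewrite rmorphD eg eh mulrDl.
    - by exists (t a * q); rewrite rmorphM eg mulrA.
  move=> _ [u [Iu ->]]; rewrite rmorph_prod.
  exists (\prod_(i < k) drop_poly 1 (t (u i))).
  rewrite -[X in _ * 'X^X](card_ord k) -prodr_const -big_split /=.
  by apply: eq_bigr => i _; rewrite drop1_poly ?t0.
case=> q eq; rewrite -[f]t1 horner_coef; apply: ideal_sum => [|i _].
  exact: ideal_exp_is_ideal.
rewrite expr1n mulr1; have [ki|ik] := leqP k i.
  exact: ideal_exp_le (tE f i).
suff -> : (t f)`_i = 0 by case: (ideal_exp_is_ideal I k).
by move/polyP: eq => ->; rewrite coefMXn ik.
Qed.

Lemma ideal_coef0 f : I f <-> (t f)`_0 = 0.
Proof.
have [hI t1 tE t0] := tI; split=> [|f0]; first exact: t0.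
rewrite -[f]t1 horner_coef; apply: ideal_sum => // i _; rewrite expr1n mulr1.
by case: i => -[|i] /= _; [rewrite f0; case: hI|apply: ideal_exp_sub (tE f _)].
Qed.

(** The constant term of [t f] serves as a normal form of [f] modulo [I]. *)
Lemma ideal_sub_coef0 f : I (f - (t f)`_0).
Proof.
have [hI t1 tE t0] := tI.
rewrite -{1}[f]t1 (horner_coef_wide _ (leqnSn _)) big_ord_recl expr0 mulr1.
rewrite addrC addKr; apply: ideal_sum => // i _; rewrite expr1n mulr1.
exact: ideal_exp_sub (tE f _).
Qed.

(** If [f] has order exactly [a], then [f * g] has order [a] plus that of [g]:
    the [T]-adic order is a valuation because [R] is a domain. *)
Lemma ideal_exp_cancel p a b f g : t f = p * 'X^a -> p`_0 != 0 ->
  ideal_exp I (a + b) (f * g) -> ideal_exp I b g.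
Proof.
move=> tf p0 /ideal_expE[q]; rewrite rmorphM tf exprD mulrAC (mulrC 'X^a) mulrA.
move=> /(mulIf (monic_neq0 (monicXn _ _))) e; apply/ideal_expE.
elim: b (t g) q e => [|b IH] G q; first by exists G; rewrite mulr1.
rewrite exprS mulrA => e; have [r er] := IH _ _ e; exists (drop_poly 1 r).
have/eqP : (p * r)`_0 = 0.
  move: e; rewrite er mulrA => /(mulIf (monic_neq0 (monicXn _ _))) ->.
  by rewrite coefMX.
rewrite coef0M mulf_eq0 (negPf p0) /= => /eqP r0.
by rewrite er -{1}(drop1_poly r0) mulrA.
Qed.

Lemma ideal_exp_cancel0 k f g :
  ~ I f -> ideal_exp I k (f * g) -> ideal_exp I k g.
Proof.
move=> If; rewrite -[k]add0n; apply: (@ideal_exp_cancel (t f)).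
  by rewrite mulr1.
by apply/negP=> /eqP/ideal_coef0.
Qed.

(** An element outside [I] has order zero, so it can be cancelled; the [k]-th
    power of an element of [I] is in [I ^ k]. *)
Lemma ideal_exp_primary k : ~ I 1 -> (0 < k)%N -> primary_ideal (ideal_exp I k).
Proof.
move=> I1 k0; have hI : is_ideal I by case: tI.
split=> [||f g Ifg]; first exact: ideal_exp_is_ideal.
  by move/(ideal_exp_sub hI k0).
have [g0|/eqP g0] := eqVneq (t g)`_0 0; last first.
  by left; apply: (@ideal_exp_cancel0 k g); rewrite 1?mulrC // ideal_coef0.
right; exists k; apply: ideal_gen_in; exists (fun=> g).
by rewrite prodr_const card_ord; split=> // _; apply/ideal_coef0.
Qed.
End ReesSection.

(** * Linear forms, points and lines of the plane *)

Lemma mpoly_gen_ind (n : nat) (A : comNzRingType) (S : {mpoly A[n]} -> Prop) :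
  (forall c, S c%:MP) -> (forall i, S 'X_i) ->
  (forall f g, S f -> S g -> S (f + g)) ->
  (forall f g, S f -> S g -> S (f * g)) -> forall f, S f.
Proof.
move=> SC SX SD SM f; rewrite [f]mpolyE.
apply: big_rec => [|m g _ Sg]; first by rewrite -mpolyC0; apply: SC.
apply: SD => //; rewrite -mul_mpolyC mpolyXE_id; apply: (SM) => //.
have S1 : S 1 by rewrite -mpolyC1; apply: SC.
elim/big_rec: _ => // i h _ Sh; apply: (SM) => //.
elim: (m i) => [|k IH]; first by rewrite expr0.
by rewrite exprS; apply: SM.
Qed.

(** Substitution of [v l + T (x - v l)] for [x], which scales by [T] the
    directions that vanish at [v]. It is locked because the unifier would
    otherwise unfold it and compare sums over supports. *)
HB.lock Definition expansion (K : fieldType) (v : 'I_3 -> K) (l : {mpoly K[3]})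
    : {mpoly K[3]} -> {poly {mpoly K[3]}} :=
  mmap (polyC \o @mpolyC 3 K)
    (fun i => (v i *: l)%:P + ('X_i - v i *: l)%:P * 'X).

Fact expansion_is_zmod_morphism (K : fieldType) (v : 'I_3 -> K) l :
  zmod_morphism (expansion v l).
Proof. by rewrite expansion.unlock; exact: raddfB. Qed.

Fact expansion_is_monoid_morphism (K : fieldType) (v : 'I_3 -> K) l :
  monoid_morphism (expansion v l).
Proof. by rewrite expansion.unlock; split; [exact: rmorph1|exact: rmorphM]. Qed.

HB.instance Definition _ (K : fieldType) (v : 'I_3 -> K) l :=
  GRing.isZmodMorphism.Build _ _ (expansion v l)
    (expansion_is_zmod_morphism v l).
HB.instance Definition _ (K : fieldType) (v : 'I_3 -> K) l :=
  GRing.isMonoidMorphism.Build _ _ (expansion v l)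
    (expansion_is_monoid_morphism v l).

Section LinearForms.
Variable K : fieldType.
Local Notation R := {mpoly K[3]}.
Implicit Types (f g l : R) (v : 'I_3 -> K) (P : proj_plane K).

Lemma linear_formE f : f \is 1.-homog -> f = \sum_i f@_U_(i) *: 'X_i.
Proof.
move=> f1; apply/mpolyP=> m; rewrite raddf_sum /=.
have [/mdeg1P[i /eqP ->]|m1] := boolP (mdeg m == 1%N).
  rewrite (bigD1 i) //= mcoeffZ mcoeffXU eqxx mulr1 big1 ?addr0 // => j ji.
  by rewrite mcoeffZ mcoeffXU (negPf ji) mulr0.
rewrite (dhomog_nemf_coeff f1 m1) big1 // => i _.
rewrite mcoeffZ mcoeffX; case: eqP => [e|_]; last by rewrite mulr0.
by rewrite -e mdeg1 in m1.
Qed.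

Lemma meval_linear_form f v :
  f \is 1.-homog -> f.@[v] = \sum_i f@_U_(i) * v i.
Proof.
move=> /linear_formE {1}->; rewrite raddf_sum /=.
by apply: eq_bigr => i _; rewrite mevalZ mevalXU.
Qed.

Lemma expansionX v l i :
  expansion v l 'X_i = (v i *: l)%:P + ('X_i - v i *: l)%:P * 'X.
Proof. by rewrite expansion.unlock mmapX mmap1U. Qed.

Lemma expansionC v l c : expansion v l c%:MP = (c%:MP)%:P.
Proof. by rewrite expansion.unlock mmapC. Qed.

Lemma expansion_horner1 v l f : (expansion v l f).[1] = f.
Proof.
elim/mpoly_gen_ind: f => [c|i|f g ef eg|f g ef eg].
- by rewrite expansionC hornerC.
- by rewrite expansionX hornerD hornerMX !hornerC mulr1 subrKC.
- by rewrite rmorphD hornerD ef eg.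
- by rewrite rmorphM hornerM ef eg.
Qed.

Lemma expansion_coef0 v l d f :
  f \is d.-homog -> (expansion v l f)`_0 = f.@[v] *: l ^+ d.
Proof.
move=> /dhomogP fd; rewrite -horner_coef0 expansion.unlock /mmap mevalE.
rewrite horner_sum scaler_suml; apply: eq_big_seq => m /fd /= dm.
rewrite hornerM hornerC mul_mpolyC -scalerA; congr (_ *: _).
rewrite /mmap1 horner_prod -dm mdegE -prodrXr -mul_mpolyC rmorph_prod /=.
rewrite -big_split /=; apply: eq_bigr => i _.
rewrite horner_exp hornerD hornerMX !hornerC mulr0 addr0 exprZn.
by rewrite -mul_mpolyC rmorphXn.
Qed.

Lemma expansion_linear_form v l f : f \is 1.-homog ->
  expansion v l f = (f.@[v] *: l)%:P + (f - f.@[v] *: l)%:P * 'X.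
Proof.
move=> f1.
have -> : f - f.@[v] *: l = \sum_i f@_U_(i) *: ('X_i - v i *: l).
  rewrite {1}(linear_formE f1) (meval_linear_form _ f1) scaler_suml -sumrB.
  by apply: eq_bigr => i _; rewrite scalerBr scalerA.
rewrite (meval_linear_form _ f1) scaler_suml !raddf_sum mulr_suml -big_split /=.
rewrite {1}(linear_formE f1) raddf_sum /=; apply: eq_bigr => i _.
rewrite -mul_mpolyC rmorphM /= expansionC expansionX mulrDr mulrA -!polyCM.
by rewrite !mul_mpolyC scalerA.
Qed.

Lemma expansion_ker_is_ideal v l :
  is_ideal (fun f => (expansion v l f)`_0 = 0).
Proof.
split=> [|f g f0 g0|f g g0]; rewrite ?raddf0 ?coef0 //.
  by rewrite rmorphD coefD f0 g0 addr0.
by rewrite rmorphM coef0M g0 mulr0.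
Qed.

(** The Rees algebra is a ring, so it is enough that it contains the expansions
    of the coordinates. *)
Lemma expansion_rees (I : R -> Prop) v l :
  is_ideal I -> (forall i, I ('X_i - v i *: l)) ->
  (forall f, I f -> (expansion v l f)`_0 = 0) ->
  rees_section I (expansion v l).
Proof.
move=> hI IX I0; split=> //; first exact: expansion_horner1.
have IC c j : ideal_exp I j (c%:P)`_j.
  rewrite coefC; case: j => [|j]; first exact: ideal_exp0.
  by case: (ideal_exp_is_ideal I j.+1).
elim/mpoly_gen_ind=> [c|i|f g If Ig|f g If Ig] j.
- by rewrite /= expansionC; apply: IC.
- rewrite /= expansionX coefD coefMX; case: (ideal_exp_is_ideal I j) => _ + _.
  apply; first exact: IC.
  case: j => [|j]; first exact: ideal_exp0.
  rewrite coefC; case: j => [|j] /=; first exact: ideal_exp1.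
  by case: (ideal_exp_is_ideal I j.+2).
- by rewrite rmorphD coefD; case: (ideal_exp_is_ideal I j) => _ + _; apply.
- rewrite rmorphM coefM; apply: ideal_sum => [|i _].
    exact: ideal_exp_is_ideal.
  by rewrite -{1}(subnKC (leq_ord i)); apply: ideal_expM.
Qed.

(** A linear form [f] that vanishes at [v] expands to [f T], so it has order
    exactly one. *)
Lemma linear_form_cancel (I : R -> Prop) v l k f g :
  rees_section I (expansion v l) -> f \is 1.-homog -> f != 0 -> f.@[v] = 0 ->
  ideal_exp I k.+1 (f * g) -> ideal_exp I k g.
Proof.
move=> tI f1 f0 fv; rewrite -(add1n k).
apply: (ideal_exp_cancel tI (p := f%:P)).
  by rewrite /= expansion_linear_form // fv scale0r subr0 add0r.
by rewrite coefC.
Qed.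

Definition hcoord P : 'I_3 -> K := fun i => vpick (val P) 0 i.

Lemma hcoord_neq0 P : vpick (val P) != 0.
Proof. by rewrite vpick0 -dimv_eq0 (eqP (valP P)). Qed.

Lemma point_rees P :
  exists l, [/\ l \is 1.-homog, l.@[hcoord P] = 1
    & rees_section (point_ideal P) (expansion (hcoord P) l)].
Proof.
have /rV0Pn[k vk] := hcoord_neq0 P.
pose l : R := (hcoord P k)^-1 *: 'X_k.
have lv : l.@[hcoord P] = 1 by rewrite mevalZ mevalXU mulVf.
have l1 : l \is 1.-homog by rewrite rpredZ // dhomogX /= mdeg1.
exists l; split=> //.
apply: expansion_rees => [|i|]; first exact: ideal_gen_is_ideal.
  apply: ideal_gen_in; split; last first.
    by rewrite /vanishes_at mevalB mevalZ mevalXU lv mulr1 subrr.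
  by exists 1%N; rewrite rpredB ?rpredZ // dhomogX /= mdeg1.
apply: ideal_gen_min => [|f [[d fd] /eqP fv]].
  exact: expansion_ker_is_ideal.
by rewrite /= (expansion_coef0 _ _ fd) fv scale0r.
Qed.

Lemma irrelevant_rees :
  rees_section (@irrelevant_ideal K) (expansion (fun=> 0) 0).
Proof.
apply: expansion_rees => [|i|]; first exact: ideal_gen_is_ideal.
  by rewrite scaler0 subr0; apply: ideal_gen_in; exists i.
apply: ideal_gen_min => [|f [i ->]]; first exact: expansion_ker_is_ideal.
by rewrite expansionX scaler0 subr0 add0r coefMX.
Qed.

Lemma linear_form_irrelevant f : f \is 1.-homog -> irrelevant_ideal f.
Proof.
move=> /linear_formE ->; apply: ideal_sum => [|i _].
  exact: ideal_gen_is_ideal.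
rewrite -mul_mpolyC.
case: (@ideal_gen_is_ideal R (fun f => exists i, f = 'X_i)).
by move=> _ _; apply; apply: ideal_gen_in; exists i.
Qed.

Lemma linear_form_point f P : f \is 1.-homog ->
  point_ideal P f <-> vanishes_at f P.
Proof.
move=> f1; split=> [|fP]; last by apply: ideal_gen_in; split=> //; exists 1%N.
have [l [_ lv tP]] := point_rees P.
have l0 : l != 0.
  by apply/eqP=> l0; move/eqP: lv; rewrite l0 meval0 eq_sym oner_eq0.
move/(ideal_coef0 tP); rewrite /= (expansion_coef0 _ _ f1) => /eqP.
by rewrite scaler_eq0 (negPf l0) orbF.
Qed.

(** The constant term of [expansion v l] is the restriction to the line through
    the origin and [v]; on that line every coordinate is a multiple of [l]. *)
Lemma coef0_irrelevant_exp v l k f : ideal_exp (@irrelevant_ideal K) k f ->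
  exists e, (expansion v l f)`_0 = e * l ^+ k.
Proof.
pose D k f := exists e, (expansion v l f)`_0 = e * l ^+ k.
have hD j : is_ideal (D j).
  split=> [|g h [a ga] [b hb]|a g [b gb]].
  - by exists 0; rewrite raddf0 coef0 mul0r.
  - by exists (a + b); rewrite rmorphD coefD ga hb mulrDl.
  - by exists ((expansion v l a)`_0 * b); rewrite rmorphM coef0M gb mulrA.
have D1 : forall g, irrelevant_ideal g -> D 1%N g.
  apply: ideal_gen_min => // _ [i ->].
  by exists (v i)%:MP; rewrite expansionX coefD coefMX coefC addr0 mul_mpolyC.
apply: (ideal_gen_min (hD k)) => _ [u [Iu ->]].
elim: k u Iu => [|k IH] u Iu.
  by exists 1; rewrite big_ord0 rmorph1 coef1 mulr1.
rewrite big_ord_recl; have [a ua] := D1 _ (Iu ord0).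
have [b ub] := IH _ (fun i => Iu (lift ord0 i)).
exists (a * b).
by rewrite rmorphM /= coef0M ua ub expr1 mulrACA exprS.
Qed.

(** The substitution of [x - l(x) w] for [x], where [l(w) = 1], maps [R] onto a
    copy of the coordinate ring of the line [l]. Working with it avoids the
    quotient by [l]: congruence modulo [l] becomes equality of images in the
    domain [R]. *)
Lemma line_retraction l : l \is 1.-homog -> l != 0 ->
  exists rho : {rmorphism R -> R},
    [/\ rho l = 0, forall f, exists h, rho f = f + h * l
      & forall f, f \is 1.-homog -> exists c : K, rho f = f + c *: l].
Proof.
move=> l1 l0.
have /existsP[k lk] : [exists k, l@_U_(k) != 0].
  rewrite -negb_forall; apply: contra l0 => /forallP l0.
  by rewrite (linear_formE l1) big1 // => i _; rewrite (eqP (l0 i)) scale0r.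
pose w (i : 'I_3) := if i == k then (l@_U_(k))^-1 else 0.
pose X := [tuple 'X_i - w i *: l | i < 3].
have rX i : 'X_i \mPo X = 'X_i - w i *: l.
  by rewrite comp_mpolyXU -tnth_nth tnth_mktuple.
have rf f : f \is 1.-homog -> f \mPo X = f - f.@[w] *: l.
  move=> f1; rewrite (meval_linear_form _ f1) {1 2}(linear_formE f1).
  rewrite scaler_suml raddf_sum /= -sumrB; apply: eq_bigr => i _.
  by rewrite comp_mpolyZ rX scalerBr scalerA.
exists (comp_mpoly X); split=> [|f|f /rf /= ->]; last first.
- by exists (- f.@[w]); rewrite scaleNr.
- elim/mpoly_gen_ind: f => [c|i|f g [a fa] [b gb]|f g [a fa] [b gb]].
  + by exists 0; rewrite /= comp_mpolyC mul0r addr0.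
  + by exists (- (w i)%:MP); rewrite /= rX mulNr mul_mpolyC.
  + by exists (a + b); rewrite rmorphD fa gb mulrDl addrACA.
  + exists (a * g + f * b + a * b * l); rewrite rmorphM fa gb.
    by ring.
rewrite /= rf // (meval_linear_form _ l1) (bigD1 k) //= /w eqxx divff //.
rewrite big1 => [|i /negPf ->]; last by rewrite mulr0.
by rewrite addr0 scale1r subrr.
Qed.

(** The common zeros of two independent linear forms are spanned by one vector,
    and a linear form that vanishes on it is a combination of the two; the ideal
    of the point is generated by such forms. *)
Lemma lines_meet l f : l \is 1.-homog -> f \is 1.-homog -> l != 0 ->
    (forall c : K, f <> c *: l) ->
  exists P, [/\ vanishes_at l P, vanishes_at f P
    & forall g, point_ideal P g -> exists a b, g = a * f + b * l].
Proof.
move=> l1 f1 l0 fl.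
pose cf (g : R) : 'rV[K]_3 := \row_i g@_U_(i).
pose lin (u : 'rV[K]_3) : R := \sum_i u 0 i *: 'X_i.
have cfK g : g \is 1.-homog -> lin (cf g) = g.
  move=> g1; rewrite [RHS](linear_formE g1).
  by apply: eq_bigr => i _; rewrite mxE.
pose B := col_mx (cf f) (cf l).
have linB (D : 'rV_(1 + 1)) :
    lin (D *m B) = lsubmx D 0 0 *: f + rsubmx D 0 0 *: l.
  rewrite -{1}[D]hsubmxK mul_row_col -{2}(cfK f) // -{2}(cfK l) //.
  rewrite !scaler_sumr -big_split; apply: eq_bigr => i _.
  by rewrite !mxE !big_ord1 scalerDl !scalerA !mxE.
have rB : \rank B = 2.
  apply/eqP; apply: inj_row_free => D DB.
  have := linB D; rewrite DB /lin big1 => [/esym e|i _]; last first.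
    by rewrite mxE scale0r.
  have D0 : lsubmx D 0 0 = 0.
    apply/eqP; apply/negPn/negP=> D0.
    apply: (fl (- (lsubmx D 0 0)^-1 * rsubmx D 0 0)).
    rewrite -scalerA scaleNr -scalerN.
    by rewrite -(addr0_eq e) opprK scalerA mulVf // scale1r.
  move: e; rewrite D0 scale0r add0r => /eqP; rewrite scaler_eq0 (negPf l0) orbF.
  move=> /eqP D1; rewrite -[D]hsubmxK; apply/eqP; rewrite row_mx_eq0.
  by apply/andP; split; apply/eqP/rowP=> i; rewrite ord1 [RHS]mxE.
have [w w0 wB] : exists2 w : 'rV_3, w != 0 & w *m B^T = 0.
  exists (nz_row (kermx B^T)); last by apply/sub_kermxP/nz_row_sub.
  by rewrite nz_row_eq0 -mxrank_eq0 mxrank_ker mxrank_tr rB.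
have dP : \dim <[w]> == 1%N by rewrite dim_vline w0.
pose P : proj_plane K := exist _ <[w]>%VS dP.
pose v := vpick (val P).
have v0 : v != 0 := hcoord_neq0 P.
have vB : v *m B^T = 0.
  have /vlineP[c ->] : v \in <[w]>%VS by apply: memv_pick.
  by rewrite -scalemxAl wB scaler0.
have evE g : g \is 1.-homog -> g.@[hcoord P] = (cf g *m v^T) 0 0.
  move=> g1; rewrite meval_linear_form // mxE.
  by apply: eq_bigr => i _; rewrite !mxE.
have Bv : B *m v^T = 0 by rewrite -[LHS]trmxK trmx_mul trmxK vB trmx0.
have [fv lv] : cf f *m v^T = 0 /\ cf l *m v^T = 0.
  by move/eqP: Bv; rewrite mul_col_mx col_mx_eq0 => /andP[/eqP ? /eqP ?].
exists P; split; first by rewrite /vanishes_at -/(hcoord P) evE // lv mxE.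
  by rewrite /vanishes_at -/(hcoord P) evE // fv mxE.
have kB : (kermx v^T <= B)%MS.
  have sB : (B <= kermx v^T)%MS by apply/sub_kermxP.
  have /eqmxP -> // : (B == kermx v^T)%MS.
  by rewrite -(mxrank_leqif_eq sB) rB mxrank_ker mxrank_tr rank_rV v0.
pose D (g : R) := exists a b, g = a * f + b * l.
have hD : is_ideal D.
  split=> [|g h [a [b ->]] [c [d ->]]|c g [a [b ->]]].
  - by exists 0, 0; rewrite !mul0r addr0.
  - by exists (a + c), (b + d); ring.
  - by exists (c * a), (c * b); ring.
have Dlin g : g \is 1.-homog -> vanishes_at g P -> D g.
  move=> g1; rewrite /vanishes_at -/(hcoord P) evE // => /eqP gv.
  have /submxP[C eC] : (cf g <= B)%MS.
    apply: submx_trans kB; apply/sub_kermxP/matrixP=> i j.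
    by rewrite !ord1 gv mxE.
  exists (lsubmx C 0 0)%:MP, (rsubmx C 0 0)%:MP.
  by rewrite !mul_mpolyC -linB -eC cfK.
move=> g; have [m [m1 mv tP]] := point_rees P.
move=> /(ideal_coef0 tP) /= g0.
suff : D (g - (expansion (hcoord P) m g)`_0) by rewrite g0 subr0.
elim/mpoly_gen_ind: {g0} g => [c|i|g h Dg Dh|g h Dg Dh].
- by rewrite expansionC coefC subrr; case: hD.
- rewrite expansionX coefD coefMX coefC addr0; apply: Dlin.
    by rewrite rpredB ?rpredZ // dhomogX /= mdeg1.
  by rewrite /vanishes_at mevalB mevalZ mevalXU mv mulr1 subrr.
- by rewrite rmorphD coefD opprD addrACA; case: hD => _ + _; apply.
- rewrite rmorphM /= coef0M.
  set a := (expansion _ _ g)`_0 in Dg *; set b := (expansion _ _ h)`_0 in Dh *.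
  rewrite (_ : _ - _ = h * (g - a) + a * (h - b)); last by ring.
  by case: hD => _ DD DM; apply: DD; apply: (DM).
Qed.
End LinearForms.

(** * Deletion of a line *)

Section Arrangement.
Variables (K : fieldType) (n : nat) (l : 'I_n -> {mpoly K[3]}).
Hypothesis l1 : forall i, l i \is 1.-homog.
Local Notation R := {mpoly K[3]}.
Implicit Types (A B : {set 'I_n}) (S : pred (proj_plane K)) (f g : R).

Definition products_omitting k A : R -> Prop :=
  ideal_gen (fun f => exists B : {set 'I_n},
    [/\ B \subset A, #|B| = (#|A| - k)%N & f = \prod_(i in B) l i]).

(** The points are limited to [S] so that the same conditions express vanishing
    in the plane and on one line. For [A] and [S] everything and [k = 2]
    they define the right-hand side of the theorem, as at a point on fewer than
    two lines the exponent truncates to [0]. *)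
Definition fat_points k A S f :=
  ideal_exp (@irrelevant_ideal K) (#|A| - k) f /\
  forall Q, S Q ->
    ideal_exp (point_ideal Q) (#|A :&: lines_through l Q| - k) f.

(** The coordinates are combinations of the [n] lines, so a matrix product
    through dimension [n] gives the identity of rank three. *)
Lemma essential_size : essential l -> (3 <= n)%N.
Proof.
move=> ess; have /fin_all_exists[c cE] (i : 'I_3) :
    exists c : 'I_n -> K, 'X_i = \sum_(j < n) c j *: l j.
  by apply: ess; rewrite dhomogX /= mdeg1.
pose C := \matrix_(i < 3, j < n) c i j.
pose L := \matrix_(j < n, k < 3) (l j)@_U_(k).
have CL : C *m L = 1%:M.
  apply/matrixP=> i k; rewrite !mxE -mcoeffXU cE raddf_sum.
  by apply: eq_bigr => j _; rewrite !mxE /= mcoeffZ.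
by rewrite -(mxrank1 K 3) -CL (leq_trans (mxrankM_maxl _ _)) ?rank_leq_col.
Qed.

Lemma omit_is_ideal k A : is_ideal (products_omitting k A).
Proof. exact: ideal_gen_is_ideal. Qed.

Lemma fat_is_ideal k A S : is_ideal (fat_points k A S).
Proof.
split=> [|f g [fm fS] [gm gS]|a f [fm fS]]; split=> [|Q SQ];
  set e := (X in ideal_exp _ X); set I := (X in ideal_exp X);
  have [H0 HD HM] := ideal_exp_is_ideal I e => //.
- exact: HD.
- by apply: HD; [apply: fS|apply: gS].
- exact: HM.
- by apply: HM; apply: fS.
Qed.

Lemma omit_full k A f : (#|A| <= k)%N -> products_omitting k A f.
Proof.
move=> Ak; rewrite -[f]mulr1; case: (omit_is_ideal k A) => _ _; apply.
apply: ideal_gen_in; exists set0; rewrite sub0set cards0 big_set0.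
by split=> //; apply/esym/eqP.
Qed.

Lemma omit_mul k A i f : i \in A ->
  products_omitting k (A :\ i) f -> products_omitting k A (l i * f).
Proof.
move=> iA; have [Ak _|kA] := leqP #|A| k; first exact: omit_full.
have [e0 eD eM] := omit_is_ideal k A.
apply: (ideal_gen_min (I := fun f => products_omitting k A (l i * f))).
  split=> [|g h|a g]; rewrite ?mulr0 ?mulrDr //; first exact: eD.
  by rewrite mulrCA; apply: eM.
move=> _ [B [sB cB ->]]; apply: ideal_gen_in; exists (i |: B).
have iB : i \notin B by apply/negP=> /(subsetP sB); rewrite !inE eqxx.
split; last by rewrite big_setU1.
  by rewrite subUset sub1set iA (subset_trans sB) ?subsetDl.
have cA : #|A| = #|A :\ i|.+1 by rewrite (cardsD1 i A) iA.
by rewrite cardsU1 iB cB cA subSn // -ltnS -cA.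
Qed.

Lemma omit_deletion k A i f : i \in A ->
  products_omitting k (A :\ i) f -> products_omitting k.+1 A f.
Proof.
move=> iA; apply: ideal_gen_min; first exact: omit_is_ideal.
move=> _ [B [sB cB ->]]; apply: ideal_gen_in; exists B; split=> //.
  exact: subset_trans sB (subsetDl _ _).
by rewrite cB (cardsD1 i A) iA subSS.
Qed.

(** Among the lines through a point, at most [k] are missing from a product
    that omits [k] lines. *)
Lemma omit_fat k A S f : products_omitting k A f -> fat_points k A S f.
Proof.
apply: ideal_gen_min; first exact: fat_is_ideal.
move=> _ [B [sB cB ->]]; split=> [|Q _].
  rewrite -cB -{1}(setIid B); apply: ideal_exp_prod => i _.
  exact: linear_form_irrelevant.
apply: ideal_exp_le (ideal_exp_prod (C := lines_through l Q) _ _); last first.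
  by move=> i; rewrite inE => lQ; apply/linear_form_point.
rewrite leq_subLR; set L := lines_through l Q.
rewrite -(cardsID B (A :&: L)) addnC leq_add //.
  apply: leq_trans (subset_leq_card (_ : _ \subset A :\: B)) _.
    by apply: setSD; apply: subsetIl.
  by rewrite cardsD (setIidPr sB) cB leq_subCl.
by apply/subset_leq_card/subsetP=> i; rewrite !inE => /andP[/andP[_ ->] ->].
Qed.

Lemma card_lines_deletion A i (Q : proj_plane K) : i \in A ->
  #|A :&: lines_through l Q| =
  (vanishes_at (l i) Q + #|(A :\ i) :&: lines_through l Q|)%N.
Proof. by move=> iA; rewrite (cardsD1 i) setIDAC !inE iA. Qed.

(** Each exponent that deleting the line [i] lowers is the exponent along an
    ideal that contains [g], which has order one there; along the other ideals
    [g] has order zero. The case [g = l i] deletes a line of the plane; the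
    other [g] are those that agree with [l i] on a line only, such as its
    image under [line_retraction]. *)
Lemma fat_residual k A S i g f :
    i \in A -> (k < #|A|)%N -> g \is 1.-homog -> g != 0 ->
    (forall Q, S Q -> vanishes_at g Q = vanishes_at (l i) Q) ->
  fat_points k A S (g * f) -> fat_points k (A :\ i) S f.
Proof.
move=> iA kA g1 g0 gS [fm fP]; split=> [|Q SQ].
  apply: (linear_form_cancel (irrelevant_rees K) g1 g0).
    rewrite meval_linear_form // big1 // => j _; exact: mulr0.
  by move: fm kA; rewrite (cardsD1 i A) iA ltnS => + kA; rewrite subSn.
have [m [_ _ tQ]] := point_rees Q.
move: (fP Q SQ); rewrite (card_lines_deletion Q iA) -gS //.
set c := #|_ :&: _|; have [gQ|gQ] := boolP (vanishes_at g Q); last first.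
  by apply: (ideal_exp_cancel0 tQ) => /(linear_form_point _ g1); apply/negP.
have [ck _|kc] := leqP c k.
  by rewrite (eqP ck : (c - k)%N = 0%N); apply: ideal_exp0.
rewrite add1n subSn 1?ltnW //.
by apply: (linear_form_cancel tQ g1 g0) => //; apply/eqP.
Qed.

(** Restricted to the line [m], this says that a binary form which vanishes at
    the points cut out by the lines of [A], to orders one less than their
    multiplicities, and whose order at the origin is at least [#|A| - 1], is a
    combination of products of all but one of the lines. *)
Lemma omit1_restriction (m : R) A f : m \is 1.-homog -> m != 0 ->
    (forall i, i \in A -> forall c : K, l i <> c *: m) ->
    fat_points 1 A (vanishes_at m) f ->
  exists2 g, products_omitting 1 A g & exists h, f = g + h * m.
Proof.
move=> m1 m0; have [c] := ubnP #|A|; elim: c A f => // c IH A f Ac Am fA.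
have [A1|A1] := leqP #|A| 1.
  by exists f; [exact: omit_full|exists 0; rewrite mul0r addr0].
have /card_gt0P[i iA] : (0 < #|A|)%N by apply: ltnW.
set A' := A :\ i; have cA : #|A| = #|A'|.+1 by rewrite (cardsD1 i A) iA.
pose M := \prod_(j in A') l j.
have omM : products_omitting 1 A M.
  apply: ideal_gen_in; exists A'; split=> //; first exact: subsetDl.
  by rewrite cA subn1.
have [P [mP iP IP]] := lines_meet m1 (l1 i) m0 (Am i iA).
(* If another line of [A] passes through [P], the hypothesis on [f] already
   gives vanishing at [P]. Otherwise [M] does not vanish there, and both [f] and
   [M] are multiples of [e ^+ #|A'|] modulo the ideal of [P], the former because
   its order at the origin is at least [#|A'|]. *)
have [r Pr] : exists r, point_ideal P (f - r * M).
  have [e [_ _ tP]] := point_rees P.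
  have hI : is_ideal (point_ideal P) by case: tP.
  have [j|MP] := pickP [pred j | (j \in A') && vanishes_at (l j) P].
    case/andP=> jA' jP; exists 0; rewrite mul0r subr0.
    apply: (ideal_exp_sub hI _ (fA.2 P mP)).
    rewrite (card_lines_deletion P iA) iP add1n subn1 /=.
    by apply/card_gt0P; exists j; rewrite inE jA' inE.
  have [a fa] := coef0_irrelevant_exp (hcoord P) e fA.1.
  pose d := \prod_(j in A') (l j).@[hcoord P].
  have d0 : d != 0.
    rewrite prodf_seq_neq0; apply/allP=> j _; apply/implyP=> jA'.
    by move: (MP j); rewrite /= jA' => /negbT.
  have M0 : (expansion (hcoord P) e M)`_0 = d *: e ^+ #|A'|.
    rewrite rmorph_prod coef0_prod -prodr_const -mul_mpolyC rmorph_prod.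
    rewrite -big_split; apply: eq_bigr => j _ /=.
    by rewrite (expansion_coef0 _ _ (l1 j)) mul_mpolyC.
  exists (d^-1 *: a).
  have -> : f - d^-1 *: a * M =
      (f - (expansion (hcoord P) e f)`_0)
      - d^-1 *: a * (M - (expansion (hcoord P) e M)`_0).
    have de : d^-1 *: a * (d *: e ^+ #|A'|) = a * e ^+ #|A'|.
      by rewrite -scalerAr -scalerAl scalerA divff // scale1r.
    by rewrite fa M0 cA subn1 mulrBr de; ring.
  apply: idealB => //; first exact: (ideal_sub_coef0 tP).
  by case: hI => _ _; apply; apply: (ideal_sub_coef0 tP).
(* Modulo [m] the difference is now a multiple of [l i]; applying the retraction
   makes it an actual multiple, to which the residual lemma applies. *)
have [a [b fab]] := IP _ Pr.
have [rho [rm rE rlin]] := line_retraction m1 m0.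
have [c0 rli] := rlin _ (l1 i).
have rli1 : rho (l i) \is 1.-homog by rewrite rli rpredD ?rpredZ.
have rli0 : rho (l i) != 0.
  apply/eqP; rewrite rli => /eqP; rewrite addr_eq0 => /eqP e.
  by apply: (Am i iA (- c0)); rewrite scaleNr.
have rliS Q : vanishes_at m Q ->
    vanishes_at (rho (l i)) Q = vanishes_at (l i) Q.
  by rewrite /vanishes_at rli mevalD mevalZ => /eqP ->; rewrite mulr0 addr0.
have fA0 : fat_points 1 A (vanishes_at m) (rho (f - r * M)).
  have [fm fP] : fat_points 1 A (vanishes_at m) (f - r * M).
    apply: idealB fA _; first exact: fat_is_ideal.
    by case: (fat_is_ideal 1 A (vanishes_at m)) => _ _; apply; apply: omit_fat.
  have rI I : is_ideal I -> I m -> forall g, I g -> I (rho g).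
    case=> _ ID IM Im g Ig; have [h ->] := rE g.
    by apply: (ID) => //; apply: IM.
  split=> [|Q mQ]; [move: fm|move: (fP Q mQ)]; apply: ideal_exp_morph.
    by apply: rI; [exact: ideal_gen_is_ideal|exact: linear_form_irrelevant].
  by apply: rI; [exact: ideal_gen_is_ideal|exact/linear_form_point].
have fA' : fat_points 1 A' (vanishes_at m) (rho a).
  apply: (fat_residual iA A1 rli1 rli0 rliS).
  by move: fA0; rewrite fab rmorphD !rmorphM /= rm mulr0 addr0 mulrC.
have [||g gA [h gE]] := IH A' (rho a) _ _ fA'; first by rewrite -ltnS -cA.
  by move=> j; rewrite inE => /andP[_]; apply: Am.
exists (r * M + l i * g).
  have [_ eD eM] := omit_is_ideal 1 A.
  by apply: (eD); [apply: eM|apply: omit_mul].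
have [u aE] := rE a; exists (h * l i - u * l i + b).
have -> : f = r * M + (a * l i + b * m) by rewrite -fab addrC subrK.
have -> : a = g + h * m - u * m by rewrite -gE aE addrK.
by ring.
Qed.

Lemma fat2_omit A f : (forall i, l i != 0) ->
    (forall i j, i != j -> forall c : K, l i <> c *: l j) ->
  fat_points 2 A predT f -> products_omitting 2 A f.
Proof.
move=> l0 lN; have [c] := ubnP #|A|; elim: c A f => // c IH A f Ac fA.
have [A2|A2] := leqP #|A| 2; first exact: omit_full.
have /card_gt0P[i iA] : (0 < #|A|)%N by rewrite (leq_trans _ A2).
have cA : #|A| = #|A :\ i|.+1 by rewrite (cardsD1 i A) iA.
have [||g gA [h fE]] := @omit1_restriction (l i) (A :\ i) f (l1 i) (l0 i).
- by move=> j; rewrite !inE => /andP[/lN].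
- split=> [|Q iQ]; first by move: fA.1; rewrite cA subSS.
  by move: (fA.2 Q isT); rewrite (card_lines_deletion Q iA) iQ subSS.
(* The residue inherits its conditions from those of [f] and of [g]. *)
have gA2 := omit_deletion iA gA.
rewrite fE (mulrC h); have [_ eD _] := omit_is_ideal 2 A; apply: eD => //.
apply: omit_mul => //; apply: IH; first by rewrite -ltnS -cA.
apply: (@fat_residual 2 A predT i (l i)) => //.
have -> : l i * h = f - g by rewrite fE addrC addKr mulrC.
apply: idealB => //; [exact: fat_is_ideal|exact: omit_fat].
Qed.
End Arrangement.

Theorem proposition2p6 (K : fieldType) (charK0 : [pchar K] =i pred0)
  (n : nat) (l : 'I_n -> {mpoly K[3]})
  (Al : line_arrangement l) (ess : essential l)
  (s : nat) (P : 'I_s -> proj_plane K)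
  (P_inj : injective P)
  (P_Sing : forall Q : proj_plane K, Sing l Q <-> exists j, Q = P j) :
  let m j := #|lines_through l (P j)| in
  (forall f : {mpoly K[3]},
     fold_products_ideal l (n - 2) f <->
     (forall j, ideal_exp (point_ideal (P j)) (m j - 2) f)
     /\ ideal_exp (@irrelevant_ideal K) (n - 2) f)
  /\ (forall j, (2 < m j)%N ->
        primary_ideal (ideal_exp (point_ideal (P j)) (m j - 2)))
  /\ primary_ideal (ideal_exp (@irrelevant_ideal K) (n - 2)).
Proof.
have [l01 lN] := Al; have l1 i := (l01 i).1; have l0 i := (l01 i).2.
have nA : (n - 2)%N = (#|[set: 'I_n]| - 2)%N by rewrite cardsT card_ord.
have omitE f : fold_products_ideal l (n - 2) f <-> products_omitting l 2 setT f.
  by rewrite nA; split; apply: ideal_gen_min;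
    try exact: ideal_gen_is_ideal; move=> g [B];
    [case=> cB ->|case=> _ cB ->]; apply: ideal_gen_in; exists B.
split; [|split].
- move=> f; rewrite omitE; split=> [fO|[fP fm]].
    have [fm fQ] := omit_fat l1 predT fO.
    split; last by rewrite nA.
    by move=> j; move: (fQ (P j) isT); rewrite setTI.
  apply: fat2_omit => //; split=> [|Q _]; first by rewrite -nA.
  rewrite setTI; have [/P_Sing[j ->]|] := boolP (Sing l Q); first exact: fP.
  rewrite /Sing -ltnNge ltnS => c1.
  by rewrite (eqP (leqW c1 : (_ - 2)%N == 0%N)); apply: ideal_exp0.
- move=> j mj; have [m [_ _ tP]] := point_rees (P j).
  apply: (ideal_exp_primary tP); last by rewrite subn_gt0.
  by move/(ideal_coef0 tP)/eqP; rewrite /= rmorph1 coef1 oner_eq0.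
- apply: (ideal_exp_primary (irrelevant_rees K)).
    move/(ideal_coef0 (irrelevant_rees K))/eqP.
    by rewrite /= rmorph1 coef1 oner_eq0.
  by rewrite subn_gt0; apply: essential_size ess.
Qed.
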